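(* Let $m\ge1$ and $n\ge0$ be integers. The number of positive real zeros of the generalized Hermite polynomial $H^{[-m]}_{2n}$ is exactly $n-m$ if $n>m$ and $0$ if $n\le m$. The number of positive real zeros of $H^{[-m]}_{2n+1}$ is exactly $n-m+1$ if $n\ge m$ and $0$ if $n<m$.
   Context: For a real parameter $\mu$, the generalized monic Hermite polynomials are $$H^{[\mu]}_{2n}(x)=\sum_{k=0}^n\binom{n+\mu-1/2}{n-k}\frac{(-1)^{n-k}n!}{k!}x^{2k},\qquad H^{[\mu]}_{2n+1}(x)=\sum_{k=0}^n\binom{n+\mu+1/2}{n-k}\frac{(-1)^{n-k}n!}{k!}x^{2k+1},$$ with $\binom{a}{k}=a(a-1)\cdots(a-k+1)/k!$. *)

(* Defs.v *)
From HB Require Import structures.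
From mathcomp Require Import all_boot all_order all_algebra.

Set Implicit Arguments.
Unset Strict Implicit.
Unset Printing Implicit Defensive.

Import GRing.Theory.
Local Open Scope ring_scope.

(* Binomial coefficient a (a - 1) ... (a - k + 1) / k! with an arbitrary upper
   argument; the coefficient 'C(n, k) only takes n : nat. *)
Definition gbinom (F : fieldType) (a : F) (k : nat) : F :=
  (\prod_(i < k) (a - i%:R)) / (k`!)%:R.

Definition genHermite_even (F : fieldType) (mu : F) (n : nat) : {poly F} :=
  \sum_(k < n.+1)
     (gbinom (n%:R + mu - 1 / 2%:R) (n - k) *
      ((-1) ^+ (n - k) * (n`!)%:R / (k`!)%:R)) *: 'X^(2 * k).

Definition genHermite_odd (F : fieldType) (mu : F) (n : nat) : {poly F} :=
  \sum_(k < n.+1)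
     (gbinom (n%:R + mu + 1 / 2%:R) (n - k) *
      ((-1) ^+ (n - k) * (n`!)%:R / (k`!)%:R)) *: 'X^(2 * k + 1).

Definition genHermite (F : fieldType) (mu : F) (j : nat) : {poly F} :=
  if odd j then genHermite_odd mu j./2 else genHermite_even mu j./2.

(* Main.v *)
(* Up to a factor x, the generalized Hermite polynomials are L_n(x^2) for the
   monic Laguerre polynomials L_n^(a), with a = -M - 1/2 where M = m in the even
   case and M = m - 1 in the odd case. One has to show that L_n^(a) has exactly
   n - M (truncated) positive zeros; everything follows from Rolle's theorem on
   ]0, +oo[ and the two ladder relations
     x^(1-a) (x^a L_n^(a))' = (n + a) L_n^(a-1),
     x^(1-a) e^x (x^a e^-x L_n^(a))' = - L_(n+1)^(a-1).
   Upper bound: the first relation shows that M |-> M + 1 loses at most one zero,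
   and for n <= M all the coefficients of L_n^(a) are positive.
   Lower bound: start from L_0^(d-1/2), d = n - M, and apply the second relation
   n times. Each step keeps the number of zeros, since x^a e^-x L vanishes at
   infinity, and as long as a > 0, i.e. in the first d steps, it gains one more,
   since x^a e^-x L also vanishes at 0. *)
Require Import Defs.
From mathcomp Require Import all_boot all_order all_algebra.
From mathcomp Require Import boolp classical_sets functions cardinality reals.
From mathcomp Require Import normedtype derive sequences exp.
From mathcomp Require Import finmap polyrcf ring lra zify.

Set Implicit Arguments.
Unset Strict Implicit.
Unset Printing Implicit Defensive.

Import Order.TTheory GRing.Theory Num.Theory.
Local Open Scope classical_set_scope.
Local Open Scope ring_scope.
Import numFieldNormedType.Exports.

(* x^(1-a) e^(l x) d/dx (x^a e^(-l x) p) *)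
Definition weighted_deriv (F : fieldType) (a l : F) (p : {poly F}) : {poly F} :=
  a *: p + 'X * p^`() - l *: ('X * p).

(** * Rolle-type lemmas for [x^a e^(-l x) p(x)] on the positive half-line *)

Section WeightedDerivative.
Variable R : realType.
Implicit Types (a l u v x : R) (p : {poly R}).

Lemma weighted_derivE a l p x :
  (weighted_deriv a l p).[x] = a * p.[x] + x * p^`().[x] - l * (x * p.[x]).
Proof. by rewrite !hornerE. Qed.

(** Mean value theorem for [x^a e^(-l x) p(x)], with [x^a] written through [ln]. Later arguments
    only compare signs, so the values of the weight are hidden in positive factors. *)
Lemma weighted_mvt a l p u v : 0 < u -> u < v ->
  exists c A B C, [/\ u < c < v, 0 < A, 0 < B, 0 < C &
    A * p.[v] - B * p.[u] = C * (weighted_deriv a l p).[c]].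
Proof.
move=> u0 uv.
pose w x : R := expR (a * ln x - l * x).
pose f x : R := w x * p.[x].
pose df x := w x * x^-1 * (weighted_deriv a l p).[x].
have fD x : 0 < x -> is_derive x 1 f (df x).
  move=> x0.
  have := is_derive1_ln x0 => lnD.
  rewrite /f /w.
  apply: is_derive_eq.
  rewrite /df weighted_derivE /w /GRing.scale /=.
  field.
  by rewrite gt_eqF.
have pos x : x \in `[u, v]%R -> 0 < x.
  by rewrite in_itv/= => /andP[ux _]; apply: lt_le_trans ux.
have fDuv x : x \in `]u, v[ -> is_derive x 1 f (df x).
  by rewrite in_itv/= => /andP[ux _]; apply/fD/(lt_trans u0).
have [c cI E] := MVT uv fDuv (derivable_within_continuous
  (fun x xI => @ex_derive _ _ _ _ _ _ _ (fD x (pos x xI)))).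
move: cI; rewrite in_itv/= => /andP[uc cv].
have c0 : 0 < c by apply: lt_trans uc.
exists c, (w v), (w u), (w c * c^-1 * (v - u)); split=> //.
- by rewrite uc.
- exact: expR_gt0.
- exact: expR_gt0.
- by rewrite !mulr_gt0 ?expR_gt0 ?invr_gt0 ?subr_gt0.
by rewrite -[LHS]/(f v - f u) E /df; ring.
Qed.

Lemma weighted_deriv_root_between a l p u v : 0 < u -> u < v ->
  root p u -> root p v ->
  exists2 c, u < c < v & root (weighted_deriv a l p) c.
Proof.
move=> u0 uv /rootP pu /rootP pv.
have [c [A [B [C [cI _ _ C0]]]]] := weighted_mvt a l p u0 uv.
rewrite pu pv !mulr0 subr0 => /esym/eqP; rewrite mulf_eq0 gt_eqF //= => qc.
by exists c.
Qed.

Lemma same_sign_near p x : p.[x] != 0 ->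
  exists2 d, 0 < d & forall y, `|y - x| < d -> 0 < p.[x] * p.[y].
Proof.
move=> px; have [d d0 H] := poly_cont x p (e := `|p.[x]|) ltac:(by rewrite normr_gt0).
exists d => // y /H {H}.
rewrite lter_norml => /andP[].
by case: (ltrgt0P p.[x]) px => // s _; nra.
Qed.

(** To stay away from 0, the mean value theorem starts at a small [u]. As [p] vanishes at [v],
    [weighted_deriv] has at some [c] the sign opposite to [p.[0]], while at 0 it equals [a *
    p.[0]]. *)
Lemma weighted_deriv_root_from0 a l p v : 0 < a -> p.[0] != 0 -> 0 < v ->
  root p v -> exists2 c, 0 < c < v & root (weighted_deriv a l p) c.
Proof.
move=> a0 p0 v0 /rootP pv; have [d d0 near0] := same_sign_near p0.
(* Below [v], and close enough to 0 for [p.[u]] to have the sign of [p.[0]]. *)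
pose u := Num.min (d / 2) (v / 2).
have u0 : 0 < u by rewrite lt_min !divr_gt0.
have uv : u < v by rewrite gt_min; apply/orP; right; lra.
have ud : u < d by rewrite gt_min; apply/orP; left; lra.
have {}near0 : 0 < p.[0] * p.[u].
  by apply: near0; rewrite subr0 gtr0_norm.
have [c [A [B [C [/andP[uc cv] _ B0 C0]]]]] := weighted_mvt a l p u0 uv.
rewrite pv mulr0 sub0r => E.
have sgn : (weighted_deriv a l p).[0] * (weighted_deriv a l p).[c] < 0.
  rewrite {1}weighted_derivE !mul0r mulr0 subr0 addr0.
  rewrite -(pmulr_rlt0 _ C0) (_ : C * _ = - (a * B * (p.[0] * p.[u]))).
    by rewrite oppr_lt0; apply: mulr_gt0 near0; apply: mulr_gt0.
  by rewrite [LHS]mulrCA -E; ring.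
have [x xI qx] := poly_ivtoo (ltW (lt_trans u0 uc)) sgn.
exists x => //; move: xI; rewrite in_itv/= => /andP[-> xc].
exact: lt_trans cv.
Qed.

(** Leading coefficients replace the limit at infinity: [p] is positive far out, so [weighted_deriv]
    is positive somewhere beyond [u], yet it is eventually negative. *)
Lemma weighted_deriv_root_after a l p u : 0 < u -> root p u ->
  0 < lead_coef p -> 0 < lead_coef (- weighted_deriv a l p) ->
  exists2 c, u < c & root (weighted_deriv a l p) c.
Proof.
move=> u0 /rootP pu lp lq.
have [X pX] := poly_pinfty_gt_lc lp; have [Y qY] := poly_pinfty_gt_lc lq.
pose v := Num.max X (u + 1).
have uv : u < v by rewrite lt_max; apply/orP; right; lra.
have pv : 0 < p.[v].
  by apply: lt_le_trans (pX v _) => //; rewrite le_max lexx.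
have [c [A [B [C [/andP[uc cv] A0 _ C0]]]]] := weighted_mvt a l p u0 uv.
rewrite pu mulr0 subr0 => E.
have qc : 0 < (weighted_deriv a l p).[c].
  by rewrite -(pmulr_rgt0 _ C0) -E mulr_gt0.
pose w := Num.max Y (c + 1).
have cw : c < w by rewrite lt_max; apply/orP; right; lra.
have qw : 0 < (- weighted_deriv a l p).[w].
  by apply: lt_le_trans (qY w _) => //; rewrite le_max lexx.
have sgn : (weighted_deriv a l p).[c] * (weighted_deriv a l p).[w] < 0.
  by rewrite pmulr_rlt0 // -oppr_gt0 -hornerN.
have [x xI qx] := poly_ivtoo (ltW cw) sgn.
exists x => //; move: xI; rewrite in_itv/= => /andP[cx _].
exact: lt_trans cx.
Qed.

(** For [p] without a known positive root. If [p.[0]] is positive, [weighted_deriv] changes sign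
    between 0 and infinity; if it is negative, [p] itself has a positive root. *)
Lemma weighted_deriv_pos_root a l p : 0 < a -> p.[0] != 0 ->
  0 < lead_coef p -> 0 < lead_coef (- weighted_deriv a l p) ->
  exists2 c, 0 < c & root (weighted_deriv a l p) c.
Proof.
move=> a0 p0 lp lq.
case: (ltrgt0P p.[0]) p0 => // sp _.
- have [Y qY] := poly_pinfty_gt_lc lq.
  pose w := Num.max Y 1.
  have w0 : 0 < w by rewrite lt_max ltr01 orbT.
  have qw : 0 < (- weighted_deriv a l p).[w].
    by apply: lt_le_trans (qY w _) => //; rewrite le_max lexx.
  have sgn : (weighted_deriv a l p).[0] * (weighted_deriv a l p).[w] < 0.
    rewrite pmulr_rlt0; first by rewrite -oppr_gt0 -hornerN.
    by rewrite weighted_derivE !mul0r mulr0 subr0 addr0 mulr_gt0.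
  have [x xI qx] := poly_ivtoo (ltW w0) sgn.
  by exists x => //; move: xI; rewrite in_itv/= => /andP[].
- have [X pX] := poly_pinfty_gt_lc lp.
  pose v := Num.max X 1.
  have v0 : 0 < v by rewrite lt_max ltr01 orbT.
  have pv : 0 < p.[v].
    by apply: lt_le_trans (pX v _) => //; rewrite le_max lexx.
  have sgn : p.[0] * p.[v] < 0 by rewrite pmulr_llt0.
  have [x] := poly_ivtoo (ltW v0) sgn.
  rewrite in_itv/= => /andP[x0 _] px.
  have p0 : p.[0] != 0 by rewrite lt_eqF.
  have [c /andP[c0 _] qc] := weighted_deriv_root_from0 l a0 p0 x0 px.
  by exists c.
Qed.

End WeightedDerivative.

(** The path starting at 0 makes the entries both positive and distinct; the list may omit roots, so
    this means at least [k] positive roots. *)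
Definition has_pos_roots (R : realType) (p : {poly R}) (k : nat) :=
  exists s : seq R, [/\ size s = k, path <%R 0 s & all (root p) s].

(** * Counting positive roots through increasing lists *)

Section PositiveRootCounts.
Variable R : realType.
Implicit Types (a l u v x : R) (p : {poly R}) (s : seq R).

(** The bound on [last] leaves room for a further point on the right; [P] is arbitrary so that it
    can also admit the point 0. *)
Lemma path_interlace (P Q : pred R) a s :
  (forall u v, P u -> P v -> u < v -> exists2 c, u < c < v & Q c) ->
  P a -> all P s -> path <%R a s ->
  exists s', [/\ size s' = size s, path <%R a s', all Q s'
    & last a s' <= last a s].
Proof.
move=> PQ; elim: s a => [|b s IH] a Pa /=; first by exists [::].
move=> /andP[Pb Ps] /andP[ab bs].
have [c /andP[ac cb] Qc] := PQ _ _ Pa Pb ab.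
have [s' [sz bs' Qs' ls']] := IH _ Pb Ps bs.
exists (c :: s'); rewrite /= sz ac Qc Qs'; split=> //.
  by case: s' bs' {sz Qs' ls'} => //= d s' /andP[/(lt_trans cb)-> ->].
case: s' {sz bs' Qs'} ls' => //= bl.
exact: le_trans (ltW cb) bl.
Qed.

Lemma path0_pos s : path <%R 0 s -> all (fun x => 0 < x) s.
Proof. by move/(order_path_min lt_trans). Qed.

Lemma pos_rootsP p s : path <%R 0 s -> all (root p) s ->
  all (fun x => (0 < x) && root p x) s.
Proof. by move=> /path0_pos s0 sp; rewrite all_predI s0. Qed.

Lemma path_weighted_deriv a l p u s :
  path <%R 0 (u :: s) -> all (root p) (u :: s) ->
  exists s', [/\ size s' = size s, path <%R u s',
    all (root (weighted_deriv a l p)) s' & last u s' <= last u s].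
Proof.
move=> s0 ps; have := pos_rootsP s0 ps => /= /andP[Pu Ps].
have /= /andP[_ us] := s0.
apply: path_interlace Pu Ps us => x y /andP[x0 px] /andP[_ py] xy.
exact: weighted_deriv_root_between.
Qed.

Lemma weighted_deriv_pos_roots a l p k : has_pos_roots p k.+1 ->
  has_pos_roots (weighted_deriv a l p) k.
Proof.
move=> [[|u s] [//= [<-] s0 ps]].
have [s' [sz us' qs' _]] := path_weighted_deriv a l s0 ps.
exists s'; split=> //; apply: path_le us'; first exact: lt_trans.
by case/andP: s0.
Qed.

(** The root beyond the largest one makes up for the one lost by interlacing. *)
Lemma weighted_deriv_keeps_pos_roots a l p k :
  0 < lead_coef p -> 0 < lead_coef (- weighted_deriv a l p) ->
  has_pos_roots p k -> has_pos_roots (weighted_deriv a l p) k.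
Proof.
move=> lp lq [[|u s] [<- s0 ps]]; first by exists [::].
have [s' [sz us' qs' ls']] := path_weighted_deriv a l s0 ps.
have /allP/(_ _ (mem_last u s))/andP[x0 px] := pos_rootsP s0 ps.
have [c lc qc] := weighted_deriv_root_after x0 px lp lq.
exists (rcons s' c); rewrite size_rcons sz all_rcons qs' qc; split=> //.
apply: (@path_le _ _ lt_trans _ u); first by case/andP: s0.
by rewrite rcons_path us'; exact: le_lt_trans lc.
Qed.

Lemma weighted_deriv_gains_pos_root a l p k : 0 < a -> p.[0] != 0 ->
  0 < lead_coef p -> 0 < lead_coef (- weighted_deriv a l p) ->
  has_pos_roots p k -> has_pos_roots (weighted_deriv a l p) k.+1.
Proof.
move=> a0 p0 lp lq [s [<- s0 ps]].
(* Since [0 < a], the weighted function vanishes at 0, which thus serves as an extra root on the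
   left. *)
pose P x := (x == 0) || ((0 < x) && root p x).
have [||||s' [sz s'0 qs' ls']] := @path_interlace P (root (weighted_deriv a l p)) 0 s.
- move=> u v Pu; rewrite /P => /orP[/eqP->|/andP[v0 pv]].
    by case/orP: Pu => [/eqP->|/andP[u0 _]]; rewrite ?ltxx// ltNge ltW.
  case/orP: Pu => [/eqP->|/andP[u0 pu]] uv.
    exact: weighted_deriv_root_from0.
  exact: weighted_deriv_root_between.
- by rewrite /P eqxx.
- by apply: sub_all (pos_rootsP s0 ps) => x; rewrite /P => ->; rewrite orbT.
- exact: s0.
have [c lc qc] : exists2 c, last 0 s < c & root (weighted_deriv a l p) c.
  case/lastP: s {sz ls'} s0 ps => [|s x] s0 ps.
    exact: weighted_deriv_pos_root.
  have := pos_rootsP s0 ps; rewrite all_rcons last_rcons => /andP[/andP[x0 px] _].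
  exact: weighted_deriv_root_after.
exists (rcons s' c); rewrite size_rcons sz rcons_path s'0 all_rcons qs' qc.
by split=> //; exact: le_lt_trans lc.
Qed.

(** A positive root missing from the list could be inserted, against maximality of [N]. The complete
    list is then carried by [Num.sqrt] onto the positive roots of [p(x^2)]. *)
Lemma pos_roots_card p N : has_pos_roots p N ->
  (forall k, has_pos_roots p k -> (k <= N)%N) ->
  ([set x : R | (0 < x) /\ root (p \Po 'X^2) x] #= `I_N)%card.
Proof.
move=> [s [sz s0 ps]] ub.
have us : uniq s.
  by have := path_sorted s0; rewrite lt_sorted_uniq_le => /andP[].
have in_s x : 0 < x -> root p x -> x \in s.
  move=> x0 px; apply/negPn/negP => xs.
  have /ub : has_pos_roots p N.+1; last by rewrite ltnn.
  exists (sort <=%R (x :: s)); rewrite size_sort /= sz; split=> //.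
    rewrite path_min_sorted.
      by rewrite sort_lt_sorted /= xs.
    by rewrite all_sort /= x0 path0_pos.
  by rewrite all_sort /= px.
have -> : [set x : R | (0 < x) /\ root (p \Po 'X^2) x]
    = [set` [fset y in [seq Num.sqrt x | x <- s]]%fset].
  apply/seteqP; split=> x /=; rewrite !inE rootE horner_comp hornerXn.
    move=> [x0 px]; apply/mapP; exists (x ^+ 2).
      by apply: in_s; rewrite ?exprn_gt0.
    by rewrite sqrtr_sqr gtr0_norm.
  move=> /mapP[y ys ->].
  have y0 : 0 < y by have /allP/(_ y ys) := path0_pos s0.
  by rewrite sqrtr_gt0 sqr_sqrtr ?ltW//; split=> //; exact: (allP ps).
apply/card_eq_fsetP; rewrite card_fseq undup_id ?size_map//.
rewrite map_inj_in_uniq // => x y /(allP (path0_pos s0)) x0 /(allP (path0_pos s0)) y0.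
by move=> /(congr1 (fun z => z ^+ 2)); rewrite !sqr_sqrtr ?ltW.
Qed.

End PositiveRootCounts.

(** * Ladder relations for the monic Laguerre polynomials *)

Section Laguerre.
Variable F : numFieldType.
Implicit Types (a l : F).

Lemma gbinomS a j : gbinom a j.+1 * j.+1%:R = gbinom a j * (a - j%:R).
Proof.
rewrite /gbinom big_ord_recr /= factS natrM.
field.
by rewrite [j`!%:R == 0]pnatr_eq0 -lt0n fact_gt0 nat1r pnatr_eq0.
Qed.

(** Both sides are [a (a - 1) ... (a - j) / j!], with the last or the first factor split off. *)
Lemma gbinom_pred a j : (a - j%:R) * gbinom a j = a * gbinom (a - 1) j.
Proof.
rewrite /gbinom !mulrA; congr (_ / _).
transitivity (\prod_(i < j.+1) (a - i%:R)).
  by rewrite big_ord_recr /= mulrC.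
rewrite big_ord_recl; congr (_ * _); first by rewrite subr0.
apply: eq_bigr => i _.
by rewrite lift0 -natr1; ring.
Qed.

Lemma gbinom0 a : gbinom a 0 = 1.
Proof. by rewrite /gbinom big_ord0 divr1. Qed.

(** This is [(-1)^n n!] times the Laguerre polynomial in its usual normalization. *)
Definition laguerre a n : {poly F} :=
  \poly_(k < n.+1)
    (gbinom (n%:R + a) (n - k) * ((-1) ^+ (n - k) * n`!%:R / k`!%:R)).

Lemma coef_laguerre a n k j : n = (j + k)%N ->
  (laguerre a n)`_k = gbinom (n%:R + a) j * ((-1) ^+ j * n`!%:R / k`!%:R).
Proof. by move=> ->; rewrite coef_poly ltnS leq_addl addnK. Qed.

Lemma coef_laguerre_gt a n k : (n < k)%N -> (laguerre a n)`_k = 0.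
Proof. by move=> nk; rewrite coef_poly ltnNge nk. Qed.

Lemma lead_coef_laguerre a n : lead_coef (laguerre a n) = 1.
Proof.
have n0 : n`!%:R != 0 :> F by rewrite pnatr_eq0 -lt0n fact_gt0.
by rewrite lead_coef_poly // subnn gbinom0 expr0 !mul1r divff // oner_neq0.
Qed.

Lemma coef_weighted_deriv a l (p : {poly F}) k :
  (weighted_deriv a l p)`_k =
  (a + k%:R) * p`_k - l * (if k == 0 then 0 else p`_k.-1).
Proof.
rewrite /weighted_deriv !(coefD, coefN, coefZ, coefXM) coef_deriv.
by case: k => [|k] /=; rewrite ?eqxx /= ?mulr_natr; ring.
Qed.

(** The coefficient of [x^k] is multiplied by [a + k = (n + a) - (n - k)], the factor absorbed by
    [gbinom_pred]. *)
Lemma weighted_deriv_laguerre0 a n :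
  weighted_deriv a 0 (laguerre a n) = (n%:R + a) *: laguerre (a - 1) n.
Proof.
apply/polyP => k; rewrite coef_weighted_deriv coefZ mul0r subr0.
have [kn|nk] := leqP k n; last by rewrite !coef_laguerre_gt // !mulr0.
have E : n = (n - k + k)%N by rewrite subnK.
rewrite !(coef_laguerre _ E) addrA.
have := gbinom_pred (n%:R + a) (n - k); rewrite natrB // => H.
have -> : a + k%:R = n%:R + a - (n%:R - k%:R) by ring.
by rewrite mulrA H -mulrA.
Qed.

Lemma weighted_deriv_laguerre1 a n :
  weighted_deriv a 1 (laguerre a n) = - laguerre (a - 1) n.+1.
Proof.
have f0 k : k`!%:R != 0 :> F by rewrite pnatr_eq0 -lt0n fact_gt0.
have S0 k : k.+1%:R != 0 :> F by rewrite pnatr_eq0.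
apply/polyP => k; rewrite coef_weighted_deriv coefN mul1r.
(* The two shifts cancel, so the binomials on both sides have the same upper argument. *)
have Ea : n.+1%:R + (a - 1) = n%:R + a by rewrite -natr1; ring.
have [kn|nk] := leqP k n; last first.
  rewrite [(laguerre a n)`_k]coef_laguerre_gt // mulr0 sub0r.
  case: k nk => // k; rewrite ltnS /= leq_eqVlt => /predU1P[<-|nk].
    by rewrite !(@coef_laguerre _ _ _ 0) // !gbinom0 !expr0 !mul1r !divff.
  by rewrite !coef_laguerre_gt.
rewrite (@coef_laguerre _ n k (n - k)) ?subnK //.
rewrite (@coef_laguerre _ n.+1 k (n - k).+1) ?addSn ?subnK // Ea.
have := gbinomS (n%:R + a) (n - k); set g' := gbinom _ _; set g := gbinom _ _ => H.
have {H} : (a + k%:R) * g = g' * (n - k).+1%:R.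
  by rewrite H natrB //; ring.
rewrite -natr1 natrB // exprS factS natrM -natr1 => H.
case: k kn @g @g' H => [|k] kn g g' H.
  rewrite /= subr0 [LHS]mulrA H.
  field.
  by rewrite f0.
rewrite /= (@coef_laguerre _ n k (n - k)) ?subnK ?(ltnW kn)//.
(* The preceding coefficient thus has the binomial [g'] too, and all terms are multiples of [g']. *)
have nk : (n - k = (n - k.+1).+1)%N by rewrite subnSK.
rewrite nk -/g' [X in X - _]mulrA H exprS factS natrM -natr1.
field.
by rewrite f0 natr1 S0.
Qed.

End Laguerre.

(** * Root counts for half-integer parameters *)

Section HalfIntegerLaguerre.
Variable R : realType.

(** Keeps the values at 0, and the factor [n + a] of the first ladder relation, from vanishing. *)
Lemma nat_diff_half_neq0 (d e : nat) : d%:R - e%:R - 1 / 2%:R != 0 :> R.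
Proof.
have [de|ed] := leqP d e.
  have : d%:R <= e%:R :> R by rewrite ler_nat.
  by move=> h; rewrite lt_eqF //; lra.
have : e.+1%:R <= d%:R :> R by rewrite ler_nat.
by rewrite -natr1 => h; rewrite gt_eqF //; lra.
Qed.

(** Lower bound, by induction on [n] for fixed [d]. The step from [n] has a positive parameter when
    [n < d], hence the minimum; the value at 0 is carried along because a gaining step needs it
    nonzero. *)
Lemma laguerre_pos_roots (d n : nat) :
  let p := laguerre (d%:R - n%:R - 1 / 2%:R : R) n in
  p.[0] != 0 /\ has_pos_roots p (minn n d).
Proof.
elim: n => [|n [p0 pr]] /=.
  rewrite min0n; split; last by exists [::].
  rewrite horner_coef0 (@coef_laguerre _ _ 0 0 0) // gbinom0 expr0 fact0.
  by rewrite !mul1r invr1 oner_neq0.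
set a : R := d%:R - n%:R - _ in p0 pr.
have Ea : d%:R - n.+1%:R - 1 / 2%:R = a - 1 by rewrite /a -natr1; ring.
rewrite Ea -[laguerre _ _]opprK -weighted_deriv_laguerre1.
have a_neq0 : a != 0 by exact: nat_diff_half_neq0.
split.
  by rewrite hornerN oppr_eq0 weighted_derivE !mul0r mulr0 subr0 addr0 mulf_neq0.
have [s H] : has_pos_roots (weighted_deriv a 1 (laguerre a n)) (minn n.+1 d).
  have lp : 0 < lead_coef (laguerre a n) by rewrite lead_coef_laguerre.
  have lq : 0 < lead_coef (- weighted_deriv a 1 (laguerre a n)).
    by rewrite weighted_deriv_laguerre1 opprK lead_coef_laguerre.
  have [dn|nd] := leqP d n.
    rewrite (_ : minn n.+1 d = minn n d); last by lia.
    exact: weighted_deriv_keeps_pos_roots.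
  rewrite (_ : minn n.+1 d = (minn n d).+1); last by lia.
  apply: weighted_deriv_gains_pos_root => //.
  have : n.+1%:R <= d%:R :> R by rewrite ler_nat.
  by rewrite -natr1 /a; lra.
by exists s; rewrite (eq_all (rootN _)).
Qed.

Lemma gbinom_neg_sign (a : R) j : a < 0 -> 0 < gbinom a j * (-1) ^+ j.
Proof.
move=> a0; elim: j => [|j IH]; first by rewrite gbinom0 mulr1.
have j1 : 0 < j.+1%:R :> R by rewrite ltr0n.
rewrite -(pmulr_rgt0 _ j1).
have -> : j.+1%:R * (gbinom a j.+1 * (-1) ^+ j.+1)
    = (j%:R - a) * (gbinom a j * (-1) ^+ j).
  by rewrite mulrA [X in X * _]mulrC gbinomS exprS; ring.
by rewrite mulr_gt0 // subr_gt0 (lt_le_trans a0).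
Qed.

(** The signs of the binomials cancel the alternating ones, so all coefficients up to degree [n] are
    positive. *)
Lemma laguerre_no_pos_root (a : R) n x : n%:R + a < 0 -> 0 < x ->
  ~~ root (laguerre a n) x.
Proof.
move=> na x0; rewrite rootE gt_eqF // horner_poly.
have pos k : 0 < gbinom (n%:R + a) (n - k)
    * ((-1) ^+ (n - k) * n`!%:R / k`!%:R) * x ^+ k.
  apply: mulr_gt0; last exact: exprn_gt0.
  rewrite -mulrA [X in 0 < X]mulrA; apply: mulr_gt0; first exact: gbinom_neg_sign.
  by rewrite divr_gt0 ?ltr0n ?fact_gt0.
rewrite big_ord_recl ltr_pwDl //.
by apply: sumr_ge0 => i _; apply: ltW.
Qed.

(** Upper bound: trading one unit of [e] for one of [M] costs at most one root by Rolle, and at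
    [e = 0] one has [n + a < 0]. *)
Lemma laguerre_pos_roots_le (e M n k : nat) : (n <= M + e)%N ->
  has_pos_roots (laguerre (- M%:R - 1 / 2%:R : R) n) k -> (k <= e)%N.
Proof.
elim: e M k => [|e IH] M [|k] // nM.
  rewrite addn0 -(ler_nat R) in nM.
  move=> [[|x s] [//= _ /andP[x0 _] /andP[px _]]].
  have na : n%:R + (- M%:R - 1 / 2%:R) < 0 :> R by lra.
  by have := laguerre_no_pos_root na x0; rewrite px.
move=> /(weighted_deriv_pos_roots (- M%:R - 1 / 2%:R) 0).
rewrite weighted_deriv_laguerre0 => -[s [sz s0 rs]].
apply: (IH M.+1 k); first by rewrite addSnnS.
exists s; split=> //; apply: sub_all rs => x.
rewrite rootZ; last by have := nat_diff_half_neq0 n M; rewrite !addrA.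
by rewrite -natr1; congr (root (laguerre _ _) _); ring.
Qed.

Lemma card_pos_roots_laguerre_sqr (M n : nat) :
  ([set x : R | 0 < x /\
     root (laguerre (- M%:R - 1 / 2%:R) n \Po 'X^2) x] #= `I_(n - M)%N)%card.
Proof.
apply: pos_roots_card; last first.
  by move=> k; apply: laguerre_pos_roots_le; rewrite -leq_subLR.
have [Mn|/ltnW] := leqP M n; last by rewrite -subn_eq0 => /eqP->; exists [::].
(* With [d = n - M], the parameter [d - n - 1/2] is [-M - 1/2]. *)
have [_] := laguerre_pos_roots (n - M) n.
rewrite (minn_idPr (leq_subr _ _)) natrB //.
by congr (has_pos_roots (laguerre _ _) _); ring.
Qed.

End HalfIntegerLaguerre.

(** * From Laguerre back to generalized Hermite polynomials *)

Lemma genHermite_evenE (F : numFieldType) (mu : F) n :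
  genHermite_even mu n = laguerre (mu - 1 / 2%:R) n \Po 'X^2.
Proof.
rewrite /laguerre poly_def rmorph_sum /=; apply: eq_bigr => k _.
by rewrite comp_polyZ comp_Xn_poly exprM addrA.
Qed.

Lemma genHermite_oddE (F : numFieldType) (mu : F) n :
  genHermite_odd mu n = 'X * (laguerre (mu + 1 / 2%:R) n \Po 'X^2).
Proof.
rewrite /laguerre poly_def rmorph_sum mulr_sumr /=; apply: eq_bigr => k _.
by rewrite comp_polyZ comp_Xn_poly -exprM addn1 exprS scalerAr addrA.
Qed.

Theorem corollary2p23 (R : realType) (m n : nat) (hm : (1 <= m)%N) :
  ([set x : R | 0 < x /\ root (genHermite (- m%:R) (2 * n)) x]
     #= `I_(if (m < n)%N then (n - m)%N else 0%N))%card /\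
  ([set x : R | 0 < x /\ root (genHermite (- m%:R) (2 * n + 1)) x]
     #= `I_(if (m <= n)%N then (n - m + 1)%N else 0%N))%card.
Proof.
rewrite /genHermite addn1 mul2n /= odd_double /= uphalf_double doubleK.
split.
  rewrite (_ : (if _ then _ else _) = n - m)%N; last by case: ltnP; lia.
  by rewrite genHermite_evenE; exact: card_pos_roots_laguerre_sqr.
(* As [m] is positive, truncated subtraction of [m.-1] covers both branches. *)
rewrite (_ : (if _ then _ else _) = n - m.-1)%N; last by case: leqP; lia.
have -> : [set x : R | 0 < x /\ root (genHermite_odd (- m%:R) n) x] =
    [set x : R | 0 < x /\ root (laguerre (- m.-1%:R - 1 / 2%:R) n \Po 'X^2) x].
  rewrite genHermite_oddE.
  have -> : - m%:R + 1 / 2%:R = - m.-1%:R - 1 / 2%:R :> R.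
    by rewrite -[in LHS](prednK hm) -natr1; field.
  (* The factor ['X] contributes only the root 0, excluded by [0 < x]. *)
  apply/seteqP; split=> x /= [x0]; rewrite rootM rootX gt_eqF //.
exact: card_pos_roots_laguerre_sqr.
Qed.
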